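(* Let $n\geq 4$. Among all $n$-vertex trees, the star $S_n$ has minimal total-eccentricity index; that is, $\tau(S_n)\leq \tau(T)$ for every $n$-vertex tree $T$.
   Context: All graphs are finite and simple. For a connected graph $G$, the eccentricity $e_G(v)$ of a vertex $v$ is the largest distance from $v$ to any other vertex of $G$, where distance is the length of a shortest path. The total-eccentricity index of $G$ is $\tau(G)=\sum_{u\in V(G)} e_G(u)$. $S_n$ denotes the star of order $n$: the tree with one vertex of degree $n-1$ and $n-1$ vertices of degree $1$. *)

(* Defs.v *)
From mathcomp Require Import all_boot.

Set Implicit Arguments.
Unset Strict Implicit.
Unset Printing Implicit Defensive.

Record sgraph := SGraph {
  vertex :> finType;
  adj : rel vertex;
  adj_sym : symmetric adj;
  adj_irr : irreflexive adj }.

Section Graph.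
Variable G : sgraph.
Implicit Types (x y v : G) (k : nat).

Definition degree x := #|[set y | adj x y]|.

Definition connected := (0 < #|G|) /\ forall x y, connect (@adj G) x y.

(* In a simple graph a cycle has at least 3 vertices; [cycle] alone would also
   accept [:: x; y] for every edge xy. *)
Definition acyclic := forall c : seq G, 2 < size c -> ~ ucycle (@adj G) c.

Definition is_tree := connected /\ acyclic.

(* Vertices of the path are x :: p, so its length (number of edges) is size p. *)
Definition is_path x y (p : seq G) :=
  [&& path (@adj G) x p, last x p == y & uniq (x :: p)].

Definition has_path k x y := [exists p : k.-tuple G, is_path x y p].

(* Least length of an x-y path; a path has fewer than #|G| edges, and the value
   is #|G| when there is no path (see distP for the connected case). *)
Definition dist x y := find (fun k => has_path k x y) (iota 0 #|G|).

Definition ecc v := \max_(u : G | u != v) dist v u.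

Definition total_ecc := \sum_(u : G) ecc u.

Lemma distP x y : connect (@adj G) x y ->
  (exists2 p, is_path x y p & size p = dist x y) /\
  (forall p, is_path x y p -> dist x y <= size p).
Proof.
have lt_size p : is_path x y p -> size p < #|G|.
  by case/and3P=> _ _ up; rewrite -[(size p).+1]/(size (x :: p)) -(card_uniqP up) max_card.
have hasp p : is_path x y p -> has_path (size p) x y.
  by move=> pP; apply/existsP; exists (in_tuple p).
move=> /connectP[q eq ylast]; split; last first.
  move=> p pP; rewrite leqNgt; apply/negP => /(before_find 0).
  by rewrite nth_iota ?lt_size // add0n hasp.
have [p pP] : exists p, is_path x y p.
  case/shortenP: eq ylast => p ep up _ ->.
  by exists p; rewrite /is_path ep up eqxx.
have hs : has (fun k => has_path k x y) (iota 0 #|G|).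
  by apply/hasP; exists (size p); rewrite ?mem_iota ?add0n ?lt_size ?hasp.
have := nth_find 0 hs; rewrite nth_iota; last first.
  by move: hs; rewrite has_find size_iota.
rewrite add0n => /existsP[r rP]; exists r => //.
by rewrite size_tuple.
Qed.

End Graph.

(* i and j are adjacent iff exactly one of them is the centre 0. *)
Definition star_adj n : rel 'I_n := fun i j => (i == 0 :> nat) (+) (j == 0 :> nat).

Lemma star_adj_sym n : symmetric (@star_adj n).
Proof. by move=> i j; rewrite /star_adj addbC. Qed.

Lemma star_adj_irr n : irreflexive (@star_adj n).
Proof. by move=> i; rewrite /star_adj addbb. Qed.

Definition star n : sgraph := SGraph (@star_adj_sym n) (@star_adj_irr n).

Lemma star_tree n : 0 < n -> is_tree (star n).
Proof.
case: n => // n _; split; first split; first by rewrite /= card_ord.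
  have c0 (x : 'I_n.+1) : connect (@star_adj n.+1) ord0 x.
    have [->|nx] := eqVneq x ord0; first exact: connect0.
    by apply: connect1; rewrite /star_adj /= -(inj_eq val_inj) /= in nx *.
  move=> x y; apply: connect_trans (c0 y).
  by rewrite (sym_connect_sym (@star_adj_sym _)); exact: c0.
case=> [|a [|b [|c s]]] //= _ /andP[].
rewrite /star_adj /= !inE !negb_or => /and3P[ab bc].
rewrite rcons_path => /andP[cs sa] /and4P[/and3P[nab nac nas] /andP[nbc nbs] ncs us].
have [a0|a1] := eqVneq (a : nat) 0; last first.
  move: ab bc; rewrite (negbTE a1) /= => b0; rewrite b0 /= => c1.
  case: s cs sa nbs {nas ncs us} => [|d s] /=.
    by move=> _; rewrite (negbTE a1) (negbTE c1).
  case/andP=> cd _ _; rewrite inE negb_or => /andP[/negP[]].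
  by apply/eqP/val_inj; move: cd b0; rewrite (negbTE c1) /= => /eqP-> /eqP->.
move: ab bc; rewrite a0 eqxx /= => b1; rewrite (negbTE b1) /= => /eqP c0.
by case/negP: nac; apply/eqP/val_inj; rewrite /= a0 c0.
Qed.

Lemma star_degrees n : 2 < n ->
  #|[set x : star n | degree x == n.-1]| = 1 /\
  #|[set x : star n | degree x == 1]| = n.-1.
Proof.
case: n => // n n1.
have d0 : degree (ord0 : star n.+1) = n.
  rewrite /degree (_ : [set y | _] = [set~ ord0]) ?cardsC1 ?card_ord //.
  by apply/setP=> y; rewrite !inE.
have d1 (x : star n.+1) : x != ord0 -> degree x = 1.
  move=> x0; rewrite /degree (_ : [set y | _] = [set ord0]) ?cards1 //.
  apply/setP=> y; rewrite !inE /= /star_adj.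
  by move: x0; rewrite -!(inj_eq val_inj) /= => /negbTE->.
split.
  rewrite (_ : [set x | _] = [set ord0]) ?cards1 //.
  apply/setP=> x; rewrite !inE /=; have [->|x0] := eqVneq x ord0.
    by rewrite d0 eqxx.
  by rewrite d1 // ltn_eqF.
rewrite (_ : [set x | _] = [set~ ord0]) ?cardsC1 ?card_ord //.
apply/setP=> x; rewrite !inE /=; have [->|x0] := eqVneq x ord0.
  by rewrite d0 gtn_eqF.
by rewrite d1.
Qed.

(* Main.v *)
Require Import Defs.
From mathcomp Require Import all_boot.

(** A vertex of eccentricity at most 1 is adjacent to all the others.  Two such
    vertices, together with any third one, would form a triangle, so a tree
    with [n >= 3] vertices has at most one of them: every other vertex
    contributes at least 2 and the last one at least 1, whence
    [1 + 2 * (n - 1) <= total_ecc T] ([total_ecc_tree_ge]).  The star meets this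
    bound: its centre is at distance 1 from each leaf, and two leaves are joined
    by a path of length 2 through the centre ([total_ecc_star_le]). *)

Lemma dist_gt0 {G : sgraph} {x y : G} : connected G -> x != y -> 0 < dist x y.
Proof.
move=> [_ cG] neq; have [[[|z p] pP <-] _] := distP (cG x y) => //.
by case/and3P: pP => _ /= xy; rewrite (negbTE neq) in xy.
Qed.

Lemma dist_gt1 {G : sgraph} {x y : G} :
  connected G -> x != y -> ~~ adj x y -> 1 < dist x y.
Proof.
move=> [_ cG] neq nadj; have [[[|z [|t p]] pP <-] _] := distP (cG x y) => //.
  by case/and3P: pP => _ /= xy; rewrite (negbTE neq) in xy.
by case/and3P: pP => /= /andP[xz _] /eqP zy; rewrite -zy xz in nadj.
Qed.

Lemma dist_le_ecc {G : sgraph} {x y : G} : x != y -> dist x y <= ecc x.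
Proof.
by move=> neq; apply: (leq_bigmax_cond (F := dist x)); rewrite eq_sym.
Qed.

Lemma ecc_gt0 {G : sgraph} {x : G} : connected G -> 1 < #|G| -> 0 < ecc x.
Proof.
move=> cG; rewrite (cardD1 x) ltnS => /card_gt0P[y]; rewrite !inE andbT eq_sym.
by move=> neq; apply: leq_trans (dist_gt0 cG neq) (dist_le_ecc neq).
Qed.

Lemma ecc_le1_adj {G : sgraph} {x y : G} :
  connected G -> ecc x <= 1 -> x != y -> adj x y.
Proof.
move=> cG ex neq; apply: contraLR ex => nadj; rewrite -ltnNge.
exact: leq_trans (dist_gt1 cG neq nadj) (dist_le_ecc neq).
Qed.

(** Otherwise the two vertices and any third one would form a triangle. *)
Lemma ecc_le1_unique {T : sgraph} {x y : T} :
  is_tree T -> 2 < #|T| -> ecc x <= 1 -> ecc y <= 1 -> x = y.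
Proof.
move=> [cT aT] gt2 ex ey; apply/eqP/negPn/negP => neq.
have [z] : exists z, z \notin [:: x; y].
  have /subsetPn[z _ zxy] : ~~ (T \subset [:: x; y]); last by exists z.
  apply: contraTN gt2 => /subset_leq_card le; rewrite -leqNgt.
  exact: leq_trans le (card_size _).
rewrite !inE negb_or => /andP[zx zy]; apply: (aT [:: x; y; z]) => //.
rewrite /ucycle /= !inE negb_or neq andbT /=.
rewrite ![_ == z]eq_sym zx zy (ecc_le1_adj cT ex neq) (ecc_le1_adj cT ey) /=.
  by rewrite adj_sym (ecc_le1_adj cT ex) // eq_sym.
by rewrite eq_sym.
Qed.

Lemma total_ecc_tree_ge {T : sgraph} :
  is_tree T -> 2 < #|T| -> 1 + 2 * #|T|.-1 <= total_ecc T.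
Proof.
move=> tT gt2; have [cT _] := tT.
have [x others] : exists x : T, forall y, y != x -> 1 < ecc y.
  case: (pickP (fun x : T => ecc x <= 1)) => [x ex | none].
    exists x => y; apply: contraNltn => ey.
    by apply/eqP; apply: ecc_le1_unique ey ex.
  by have /card_gt0P[x _] := cT.1; exists x => y _; rewrite ltnNge none.
rewrite /total_ecc (bigD1 x) //= leq_add ?ecc_gt0 ?(ltnW gt2) //.
by rewrite -(cardC1 x) mulnC -sum_nat_const leq_sum.
Qed.

Lemma dist_star_centre {n} {y : star n.+1} :
  y != ord0 -> dist (ord0 : star n.+1) y <= 1.
Proof.
move=> y0; have [[_ cS] _] := star_tree (ltn0Sn n).
have [_ /(_ [:: y])] := distP (cS ord0 y); apply.
rewrite /is_path /= /star_adj !inE eqxx [ord0 == y]eq_sym y0 !andbT.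
by move: y0; rewrite -(inj_eq val_inj) /= => /negbTE->.
Qed.

Lemma dist_star_leaf {n} {x y : star n.+1} :
  x != ord0 -> x != y -> dist x y <= 2.
Proof.
move=> x0 xy; have [[_ cS] _] := star_tree (ltn0Sn n).
have [_ dle] := distP (cS x y); have [y0|y0] := eqVneq y ord0.
  apply: (leq_trans (dle [:: y] _)) => //.
  rewrite /is_path /= /star_adj !inE eqxx xy !andbT y0 /=.
  by move: x0; rewrite -(inj_eq val_inj) /= => /negbTE->.
apply: (dle [:: ord0 : star n.+1; y]).
rewrite /is_path /= /star_adj !inE eqxx negb_or x0 xy [ord0 == y]eq_sym y0 !andbT.
by move: x0 y0; rewrite -!(inj_eq val_inj) /= => /negbTE-> /negbTE->.
Qed.

Lemma total_ecc_star_le n : total_ecc (star n.+1) <= 1 + 2 * n.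
Proof.
rewrite /total_ecc (bigD1 (ord0 : star n.+1)) //= leq_add //.
  by apply/bigmax_leqP => y; apply: dist_star_centre.
have -> : 2 * n = \sum_(x : star n.+1 | x != ord0) 2.
  by rewrite sum_nat_const cardC1 card_ord mulnC.
apply: leq_sum => x x0.
by apply/bigmax_leqP => y yx; rewrite dist_star_leaf // eq_sym.
Qed.

Theorem theorem2p7 (n : nat) (hn : 4 <= n) (T : sgraph)
  (hT : is_tree T) (hcard : #|T| = n) :
  total_ecc (star n) <= total_ecc T.
Proof.
have gt2 : 2 < #|T| by rewrite hcard ltnW.
apply: leq_trans (total_ecc_tree_ge hT gt2); rewrite hcard.
by case: n hn {hcard} => // n _; apply: total_ecc_star_le.
Qed.
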